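(* Let $\mathrm{Pen}:\mathbb R^{p\times(K-1)}\to[0,\infty)$ satisfy $\mathrm{Pen}(B)=\mathrm{Pen}(BR)$ for any $B\in\mathbb R^{p\times(K-1)}$ and any orthogonal matrix $R\in\mathbb R^{(K-1)\times(K-1)}$. Let $\widetilde\Theta\in\mathbb R^{K\times(K-1)}$ be such that $\widetilde\Theta^\top Z^\top Z\widetilde\Theta=nI_{K-1}$ and $\widetilde\Theta^\top Z^\top Z\mathbf 1=\mathbf 0$, and let $$B_{\widetilde\Theta}=\arg\min_{B\in\mathbb R^{p\times(K-1)}}\left\{(2n)^{-1}\|Z\widetilde\Theta-XB\|_F^2+\lambda\,\mathrm{Pen}(B)\right\}.$$ Then the pair $(\widetilde\Theta,B_{\widetilde\Theta})$ attains the global minimum of the problem $$\text{minimize over }\Theta\in\mathbb R^{K\times(K-1)},\,B\in\mathbb R^{p\times(K-1)}:\quad (2n)^{-1}\|Z\Theta-XB\|_F^2+\lambda\,\mathrm{Pen}(B)$$ $$\text{subject to}\quad \Theta^\top Z^\top Z\Theta=nI_{K-1},\qquad \Theta^\top Z^\top Z\mathbf 1=\mathbf 0 .$$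
   Context: $K\ge2$ is the number of classes, $X\in\mathbb R^{n\times p}$ is a column-centered data matrix, and $Z\in\{0,1\}^{n\times K}$ is the class indicator matrix ($Z_{ik}=1$ if sample $i$ belongs to class $k$ and $0$ otherwise, each sample belonging to exactly one class). $\mathbf 1\in\mathbb R^K$ is the vector of ones, $\|\cdot\|_F$ is the Frobenius norm, and $\lambda>0$ is a tuning parameter. *)

(* Defs.v *)
From mathcomp Require Import all_boot all_order all_algebra.
From mathcomp Require Import classical_sets reals.

Set Implicit Arguments.
Unset Strict Implicit.
Unset Printing Implicit Defensive.

Import Order.TTheory GRing.Theory Num.Theory.
Local Open Scope ring_scope.
Local Open Scope classical_set_scope.

(* The set of global minimizers of f over S; it may be empty or contain
   several points. *)
Definition argmin (R : realType) (T : Type) (S : set T) (f : T -> R) : set T :=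
  [set x | S x /\ forall y, S y -> f x <= f y].

Definition frob_norm (R : realType) (m n : nat) (A : 'M[R]_(m, n)) : R :=
  Num.sqrt (\sum_i \sum_j A i j ^+ 2).

Definition orthogonal_mx (R : realType) (m : nat) (Q : 'M[R]_m) : Prop :=
  Q^T *m Q = 1%:M.

Definition column_centered (R : realType) (n p : nat) (X : 'M[R]_(n, p)) :
    Prop :=
  forall j, \sum_i X i j = 0.

Definition class_indicator (R : realType) (n K : nat) (Z : 'M[R]_(n, K)) :
    Prop :=
  (forall i k, Z i k = 0 \/ Z i k = 1) /\ (forall i, exists! k, Z i k = 1).

Definition scoring_objective (R : realType) (n p K : nat) (X : 'M[R]_(n, p))
    (Z : 'M[R]_(n, K)) (lambda : R) (Pen : 'M[R]_(p, K.-1) -> R)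
    (Theta : 'M[R]_(K, K.-1)) (B : 'M[R]_(p, K.-1)) : R :=
  (2 * n%:R)^-1 * frob_norm (Z *m Theta - X *m B) ^+ 2 + lambda * Pen B.

Definition feasible_scores (R : realType) (n K : nat) (Z : 'M[R]_(n, K)) :
    set 'M[R]_(K, K.-1) :=
  [set Theta | Theta^T *m Z^T *m Z *m Theta = n%:R%:M /\
               Theta^T *m Z^T *m Z *m (const_mx 1 : 'cV[R]_K) = 0].

(* Main.v *)
Require Import Defs.
From mathcomp Require Import all_boot all_order all_algebra.
From mathcomp Require Import classical_sets reals.

(** The objective does not change when [Theta] and [B] are multiplied on the
    right by a common orthogonal matrix: the residual is multiplied by it too,
    and both the Frobenius norm and the penalty ignore such a factor
    ([scoring_objective_rotate]).  It is therefore enough that any two feasible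
    score matrices differ by an orthogonal factor on the right, say
    [Theta' = Theta Q] ([feasible_scores_rotation]).  Granting this, a
    competitor [(Theta', B)] has the same value as [(Theta, B Q^T)], which the
    choice of [BTheta] bounds from below.

    The factor exists because feasible scores fill up the space.  Every sample
    has exactly one class, so [Z 1 = 1] and the all-ones vector has squared
    length [n] for the form [S = Z^T Z].  The constraints then say that the
    all-ones vector and the [K - 1] columns of [Theta] form an orthogonal basis
    of [R^K] for [S], all of squared length [n].  Expanding the columns of
    [Theta'] in this basis, the coefficients along the all-ones vector vanish
    by the centering constraint, so [Theta' = Theta Q]; the normalization of
    both matrices makes [Q] orthogonal. *)

Import Order.TTheory GRing.Theory Num.Theory.
Local Open Scope ring_scope.
Local Open Scope classical_set_scope.

(** Parseval's identity for [u] and the columns of [T]: the matrix [row_mx u T]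
    is square, so its left inverse [c^-1 *: (row_mx u T)^T *m S] is also a right
    inverse. *)
Lemma orthogonal_basis_resolution {F : fieldType} {m : nat} {S : 'M[F]_(1 + m)}
    {u : 'cV[F]_(1 + m)} {T : 'M[F]_(1 + m, m)} {c : F} :
  c != 0 -> S^T = S ->
  u^T *m S *m u = c%:M -> T^T *m S *m u = 0 -> T^T *m S *m T = c%:M ->
  c^-1 *: (u *m u^T + T *m T^T) *m S = 1%:M.
Proof.
move=> c_neq0 symS uu Tu TT.
have uT : u^T *m S *m T = 0.
  by apply: trmx_inj; rewrite !trmx_mul trmxK symS mulmxA Tu trmx0.
have gram : (c^-1 *: ((row_mx u T)^T *m S)) *m row_mx u T = 1%:M.
  rewrite -scalemxAl tr_row_mx mul_col_mx mul_col_row uu uT Tu TT.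
  by rewrite -scalar_mx_block scale_scalar_mx mulVf.
move/mulmx1C: gram; rewrite -scalemxAr mulmxA tr_row_mx mul_row_col.
by rewrite scalemxAl.
Qed.

(** The factor consists of the coefficients of the columns of [T'] in the
    orthogonal basis given by [u] and the columns of [T]. *)
Lemma orthogonal_frames_rotation {F : fieldType} {m : nat} {S : 'M[F]_(1 + m)}
    {u : 'cV[F]_(1 + m)} {T T' : 'M[F]_(1 + m, m)} {c : F} :
  c != 0 -> S^T = S -> u^T *m S *m u = c%:M ->
  T^T *m S *m T = c%:M -> T^T *m S *m u = 0 ->
  T'^T *m S *m T' = c%:M -> T'^T *m S *m u = 0 ->
  exists2 Q : 'M[F]_m, Q^T *m Q = 1%:M & T' = T *m Q.
Proof.
move=> c_neq0 symS uu TT Tu T'T' T'u.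
have uT' : u^T *m S *m T' = 0.
  by apply: trmx_inj; rewrite !trmx_mul trmxK symS mulmxA T'u trmx0.
pose Q := c^-1 *: (T^T *m S *m T').
have T'E : T' = T *m Q.
  rewrite -[LHS]mul1mx -(orthogonal_basis_resolution c_neq0 symS uu Tu TT).
  rewrite -!scalemxAl !mulmxDl -!mulmxA (mulmxA u^T) uT' mulmx0 add0r.
  by rewrite -scalemxAr !mulmxA.
exists Q => //.
apply: (scalerI c_neq0); rewrite scalemx1 -T'T' [in RHS]T'E trmx_mul.
rewrite -!mulmxA (mulmxA S) (mulmxA T^T) (mulmxA T^T) TT.
by rewrite mul_scalar_mx scalemxAr.
Qed.

Lemma class_indicator_mul1 {R : realType} {n K : nat} {Z : 'M[R]_(n, K)} :
  class_indicator Z -> Z *m (const_mx 1 : 'cV[R]_K) = const_mx 1.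
Proof.
case=> Z01 Zexists; apply/matrixP => i j; rewrite !mxE.
have [k [Zik k_uniq]] := Zexists i.
rewrite (bigD1 k) //= Zik mxE mulr1 big1 ?addr0 // => l l_neq_k.
case: (Z01 i l) => [-> | Zil]; first by rewrite mul0r.
by move: l_neq_k; rewrite (k_uniq l Zil) eqxx.
Qed.

Lemma feasible_scores_rotation {R : realType} {n K : nat} {Z : 'M[R]_(n, K)}
    {Theta Theta' : 'M[R]_(K, K.-1)} :
  (0 < n)%N -> (0 < K)%N -> class_indicator Z ->
  feasible_scores Z Theta -> feasible_scores Z Theta' ->
  exists2 Q : 'M[R]_K.-1, orthogonal_mx Q & Theta' = Theta *m Q.
Proof.
case: K Z Theta Theta' => [//|m] Z Theta Theta' n_gt0 _ hZ [TT T1] [T'T' T'1].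
apply: (@orthogonal_frames_rotation _ m (Z^T *m Z) (const_mx 1) Theta Theta'
          n%:R); rewrite ?mulmxA //.
- by rewrite pnatr_eq0 -lt0n.
- by rewrite trmx_mul trmxK.
rewrite -mulmxA -trmx_mul class_indicator_mul1 //.
apply/matrixP => i j; rewrite !mxE !ord1 mulr1n.
under eq_bigr do rewrite !mxE mulr1.
by rewrite sumr_const card_ord.
Qed.

Lemma frob_normE {R : realType} {m n : nat} {A : 'M[R]_(m, n)} :
  frob_norm A = Num.sqrt (\tr (A *m A^T)).
Proof.
congr Num.sqrt; apply: eq_bigr => i _; rewrite mxE.
by apply: eq_bigr => j _; rewrite mxE expr2.
Qed.

Lemma frob_norm_mul_orthogonal {R : realType} {m n : nat} {A : 'M[R]_(m, n)}
    {Q : 'M[R]_n} :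
  orthogonal_mx Q -> frob_norm (A *m Q) = frob_norm A.
Proof.
move=> /mulmx1C QQ.
by rewrite !frob_normE trmx_mul mulmxA -(mulmxA A) QQ mulmx1.
Qed.

Lemma scoring_objective_rotate {R : realType} {n p K : nat} {X : 'M[R]_(n, p)}
    {Z : 'M[R]_(n, K)} {lambda : R} {Pen : 'M[R]_(p, K.-1) -> R}
    {Theta : 'M[R]_(K, K.-1)} {B : 'M[R]_(p, K.-1)} {Q : 'M[R]_K.-1} :
  (forall (B : 'M[R]_(p, K.-1)) (Q : 'M[R]_K.-1),
      orthogonal_mx Q -> Pen B = Pen (B *m Q)) ->
  orthogonal_mx Q ->
  scoring_objective X Z lambda Pen (Theta *m Q) (B *m Q) =
  scoring_objective X Z lambda Pen Theta B.
Proof.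
move=> Pen_orth Qorth; rewrite /scoring_objective -Pen_orth // !mulmxA.
by rewrite -mulmxBl frob_norm_mul_orthogonal.
Qed.

Theorem lemma1 (R : realType) (n p K : nat) (hn : (0 < n)%N) (hK : (2 <= K)%N)
    (X : 'M[R]_(n, p)) (hX : column_centered X)
    (Z : 'M[R]_(n, K)) (hZ : class_indicator Z)
    (lambda : R) (hlambda : 0 < lambda)
    (Pen : 'M[R]_(p, K.-1) -> R)
    (hPen_ge0 : forall B : 'M[R]_(p, K.-1), 0 <= Pen B)
    (hPen_orth : forall (B : 'M[R]_(p, K.-1)) (Q : 'M[R]_K.-1),
        orthogonal_mx Q -> Pen B = Pen (B *m Q))
    (Theta : 'M[R]_(K, K.-1)) (hTheta : feasible_scores Z Theta)
    (BTheta : 'M[R]_(p, K.-1))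
    (hB : argmin [set: 'M[R]_(p, K.-1)]
            (fun B => scoring_objective X Z lambda Pen Theta B) BTheta) :
  argmin [set TB : 'M[R]_(K, K.-1) * 'M[R]_(p, K.-1) | feasible_scores Z TB.1]
    (fun TB => scoring_objective X Z lambda Pen TB.1 TB.2) (Theta, BTheta).
Proof.
split=> // -[Theta' B] /= hTheta'.
have [Q Qorth ->] := feasible_scores_rotation hn (ltnW hK) hZ hTheta hTheta'.
have -> : B = B *m Q^T *m Q by rewrite -mulmxA Qorth mulmx1.
by rewrite scoring_objective_rotate //; apply: hB.2.
Qed.
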